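(* Let $H$ be a graph and $W\subseteq V(H)$ nonempty. Then $\gamma(H)\ge \varepsilon(H,W)\cdot|W|^2/108$.
   Context: For $u,v\in V(H)$, $\mathcal P_H(u,v)$ is the set of paths from $u$ to $v$ in $H$; for $u=v$ it contains only the one-vertex path $(u)$. The concurrent flow LP for $H$ and $W$ with vertex capacity $C>0$: maximize $\varepsilon$ subject to $\sum_{p\in\mathcal P_H(u,v)}x_p\ge\varepsilon$ for all $u,v\in W$; $\sum_{u,v\in W}\sum_{p\in\mathcal P_H(u,v):\,w\in p}x_p\le C$ for all $w\in V(H)$; $x_p\ge0$. $\varepsilon(H,W)$ is the optimal value for $C=1$. Blowup: $H\otimes J_t$ has vertices $v^{(i)}$ ($v\in V(H)$, $i\in[t]$) and edges $u^{(i)}v^{(j)}$ for $uv\in E(H)$, all $i,j\in[t]$, and $u^{(i)}u^{(j)}$ for $u\in V(H)$, $i\neq j$. A matching on $X$ is a set of pairwise disjoint unordered pairs of distinct vertices of $X$ (not necessarily edges); $X$ is matching-linked in a graph if for every matching $M$ on $X$ there are pairwise vertex-disjoint paths connecting the two vertices of each pair of $M$. Linkage capacity $\gamma(H)$: the supremum of all $c>0$ such that for all sufficiently large $t$ the blowup $H\otimes J_t$ contains a matching-linked set of size $\lfloor ct\rfloor$. *)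

(* Defs.v *)
From HB Require Import structures.
From mathcomp Require Import all_boot all_order all_algebra.
From mathcomp Require Import all_classical all_reals.
From mathcomp Require Import ereal Rstruct.
From Stdlib Require Import Rdefinitions.
Set Implicit Arguments. Unset Strict Implicit. Unset Printing Implicit Defensive.
Import Order.TTheory GRing.Theory Num.Theory.
Local Open Scope ring_scope.


Definition simple_graph (V : finType) (E : rel V) : Prop :=
  symmetric E /\ irreflexive E.

Fixpoint all_seqs (V : finType) (n : nat) : seq (seq V) :=
  match n with
  | 0 => [:: [::]]
  | n'.+1 => [seq x :: s | x <- enum V, s <- all_seqs V n']
  end.

(* s is (the vertex sequence of) a path from u to v in the graph E:
   distinct vertices, consecutive ones adjacent. For u = v this is only (u). *)
Definition is_path_uv (V : finType) (E : rel V) (u v : V) (s : seq V) : bool :=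
  match s with
  | [::] => false
  | x :: s' => [&& x == u, last x s' == v, uniq s & path E x s']
  end.

Definition paths_uv (V : finType) (E : rel V) (u v : V) : seq (seq V) :=
  [seq s <- flatten [seq all_seqs V k | k <- iota 1 #|V|] | is_path_uv E u v s].

Definition cflow_feasible (V : finType) (E : rel V) (W : {set V}) (C : R)
    (eps : R) (x : seq V -> R) : Prop :=
  [/\ (forall u v, u \in W -> v \in W -> eps <= \sum_(p <- paths_uv E u v) x p),
      (forall w : V, \sum_(u in W) \sum_(v in W)
                        \sum_(p <- paths_uv E u v | w \in p) x p <= C)
    & (forall p, 0 <= x p)].

Definition eps_HW (V : finType) (E : rel V) (W : {set V}) : \bar R :=
  ereal_sup [set e%:E | e in [set e : R | exists x, cflow_feasible E W 1 e x]%classic]%classic.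

Definition blowup (V : finType) (E : rel V) (t : nat) : rel (V * 'I_t) :=
  fun a b => E a.1 b.1 || ((a.1 == b.1) && (a.2 != b.2)).

Arguments blowup {V} E t.

Definition matching_on (T : finType) (X : {set T}) (M : {set {set T}}) : Prop :=
  (forall e, e \in M -> #|e| = 2 /\ e \subset X) /\
  (forall e f, e \in M -> f \in M -> e != f -> [disjoint e & f]).

Definition matching_linked (T : finType) (G : rel T) (X : {set T}) : Prop :=
  forall M : {set {set T}}, matching_on X M ->
    exists P : {set T} -> seq T,
      (forall e, e \in M -> exists u v, e = [set u; v] /\ is_path_uv G u v (P e)) /\
      (forall e f, e \in M -> f \in M -> e != f ->
         [disjoint [pred z | z \in P e] & [pred z | z \in P f]]).

Definition linkage_capacity (V : finType) (E : rel V) : \bar R :=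
  ereal_sup [set c%:E | c in [set c : R | 0 < c /\
     exists t0 : nat, forall t : nat, leq t0 t ->
       exists X : {set V * 'I_t},
         #|X|%:Z = Num.floor (c * t%:R) /\ matching_linked (blowup E t) X]%classic]%classic.

(* Main.v *)
(** Let [k = #|W|] and let [x] be a feasible flow of value [eps > 0]. Take as
    terminals about [eps * k * t / 108] copies of every vertex of [W]. Given a
    matching on them, spread the pairs of each type evenly over intermediate
    vertices of [W] and route both halves along [x]; the load of every vertex of
    [H] is about [t / 54]. Since [H] is fixed, rounding this fractional routing
    up costs only a constant independent of [t], so no concentration inequality
    is needed. Walks of [H] visiting every vertex at most [t - m] times lift to
    disjoint paths of the blowup, where [m] bounds the number of terminals over
    a vertex. *)

Require Import Defs.
From HB Require Import structures.
From mathcomp Require Import all_boot all_order all_algebra.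
From mathcomp Require Import all_classical all_reals.
From mathcomp Require Import ereal Rstruct.
From mathcomp Require Import zify ring lra.
From Stdlib Require Import Rdefinitions.
Set Implicit Arguments.
Unset Strict Implicit.
Unset Printing Implicit Defensive.
Import Order.TTheory GRing.Theory Num.Theory.
Local Open Scope ring_scope.

(** * Rounding a fractional assignment *)

(** Within each fibre of [tau], the element of rank [j] takes the entry of [L k] at position [j].
    The fibre thus uses a prefix of the list, in which no property can occur more often than in the
    whole. *)
Lemma assign_from_lists (I K : finType) (O : eqType) (o0 : O) (tau : I -> K)
    (L : K -> seq O) :
  (forall k, (#|[pred i | tau i == k]| <= size (L k))%nat) ->
  exists f : I -> O, (forall i, f i \in L (tau i)) /\
    forall k (P : pred O),
      (#|[pred i | (tau i == k) && P (f i)]| <= count P (L k))%nat.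
Proof.
move=> hL; pose F k := enum [pred i | tau i == k].
pose f i := nth o0 (L (tau i)) (index i (F (tau i))).
have szF k : (size (F k) <= size (L k))%nat by rewrite /F -cardE; exact: hL.
have memF i : i \in F (tau i) by rewrite mem_enum inE.
exists f; split=> [i|k P].
  by rewrite mem_nth // (leq_trans _ (szF (tau i))) // index_mem.
have fF : map f (F k) = take (size (F k)) (L k).
  apply: (@eq_from_nth _ o0); first by rewrite size_map size_takel.
  move=> j; rewrite size_map => jlt.
  have [i0 _] : {i0 : I & true} by case: (F k) jlt => // i0; exists i0.
  rewrite (nth_map i0) // nth_take //.
  have : nth i0 (F k) j \in F k by rewrite mem_nth.
  rewrite {1}/F mem_enum inE => /eqP tk.
  by rewrite /f tk index_uniq // enum_uniq.
have -> : #|[pred i | (tau i == k) && P (f i)]| = count P (map f (F k)).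
  rewrite count_map -size_filter cardE /F /enum_mem -filter_predI.
  by congr size; apply: eq_filter => i; rewrite !inE andbC.
rewrite fF -{2}(cat_take_drop (size (F k)) (L k)) count_cat leq_addr //.
Qed.

(** Offer each [o] in [s k] the floor of [d k * y k o], plus one, times. Weights of total at least 1
    make the list long enough for the fibre, and rounding up costs at most 1 per entry of [s k]. *)
Lemma fractional_rounding (I K : finType) (O : eqType) (o0 : O) (tau : I -> K)
    (s : K -> seq O) (y : K -> O -> R) :
  (forall k o, 0 <= y k o) ->
  (forall i, 1 <= \sum_(o <- s (tau i)) y (tau i) o) ->
  exists f : I -> O, (forall i, f i \in s (tau i)) /\
    forall k (P : pred O),
      #|[pred i | (tau i == k) && P (f i)]|%:R <=
      #|[pred i | tau i == k]|%:R * \sum_(o <- s k | P o) y k o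
        + (size (s k))%:R.
Proof.
move=> y0 y1.
pose d k := #|[pred i | tau i == k]|.
pose c k o := (Num.truncn ((d k)%:R * y k o)).+1.
pose L k := flatten [seq nseq (c k o) o | o <- s k].
have cntL k (P : pred O) : count P (L k) = (\sum_(o <- s k | P o) c k o)%nat.
  rewrite /L count_flatten -map_comp sumnE big_map [RHS]big_mkcond /=.
  by apply: eq_bigr => o _; rewrite /= count_nseq; case: (P o); rewrite ?mul1n.
have dy0 k o : 0 <= (d k)%:R * y k o by rewrite mulr_ge0.
have hL k : (#|[pred i | tau i == k]| <= size (L k))%nat.
  case: (posnP #|[pred i | tau i == k]|) => [-> //|/card_gt0P[i]]; rewrite inE => /eqP tk.
  rewrite -count_predT cntL -(ler_nat R) natr_sum.
  apply: (@le_trans _ _ ((d k)%:R * \sum_(o <- s k) y k o)).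
    by rewrite ler_peMr // -tk.
  by rewrite mulr_sumr ler_sum // => o _; rewrite ltW // -truncn_lt_nat.
have [f [fL fP]] := assign_from_lists o0 hL.
exists f; split=> [i|k P].
  have /flattenP[l /mapP[o os ->]] := fL i.
  by rewrite mem_nseq => /andP[_ /eqP ->].
apply: le_trans (_ : (count P (L k))%:R <= _); first by rewrite ler_nat.
rewrite cntL natr_sum mulr_sumr.
apply: (@le_trans _ _ (\sum_(o <- s k | P o) ((d k)%:R * y k o + 1))).
  by apply: ler_sum => o _; rewrite /c -natr1 lerD2r truncn_le.
rewrite big_split /= lerD2l big_const_seq iter_addr addr0 ler_nat.
exact: count_size.
Qed.

(** * Lifting routes to disjoint paths of the blowup *)

Lemma index_enum_inj (I : finType) (P : pred I) (i j : I) :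
  P i -> P j -> index i (enum P) = index j (enum P) -> i = j.
Proof.
move=> Pi Pj /(congr1 (nth i (enum P))).
by rewrite !nth_index // mem_enum.
Qed.

(** Of the [t] copies of a vertex, the first [m] are reserved for terminals, leaving [t - m] for
    inner vertices. The ends of a route are lifted to the terminals themselves, so they do not count
    towards the load. *)
Lemma matching_linked_of_routing (V : finType) (E : rel V) (t m : nat)
    (X : {set V * 'I_t}) :
  (m <= t)%nat -> (forall x, x \in X -> (x.2 < m)%nat) ->
  (forall (I : finType) (a b : I -> V * 'I_t),
    (forall i, a i \in X) -> (forall i, b i \in X) ->
    injective a -> injective b ->
    exists s : I -> seq V, (forall i, is_path_uv E (a i).1 (b i).1 (s i)) /\
      forall z, (#|[pred i | [&& z \in s i, z != (a i).1 & z != (b i).1]]|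
                 <= t - m)%nat) ->
  matching_linked (blowup E t) X.
Proof.
move=> mt Xm route M [M2 Mdisj].
pose I := {e : {set V * 'I_t} | e \in M}.
pose v (i : I) : {set V * 'I_t} := sval i.
have MI i : v i \in M := svalP i.
have vinj : injective v := val_inj.
have /fin_all_exists[ab abP] (i : I) :
    exists p : (V * 'I_t) * (V * 'I_t), p.1 != p.2 /\ v i = [set p.1; p.2].
  by have [/eqP/cards2P[x [y [xy ->]]] _] := M2 _ (MI i); exists (x, y).
pose a i := (ab i).1; pose b i := (ab i).2.
have aV i : a i \in v i by rewrite (abP i).2 set21.
have bV i : b i \in v i by rewrite (abP i).2 set22.
have VX i : v i \subset X by case: (M2 _ (MI i)).
have Veq (i j : I) z : z \in v i -> z \in val j -> i = j.
  move=> zi zj; apply: vinj; apply: contraTeq isT => /(Mdisj _ _ (MI i) (MI j)).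
  by move=> /disjointFr /(_ zi); rewrite zj.
have aX (i : I) : a i \in X by exact: (fintype.subsetP (VX i) _ (aV i)).
have bX (i : I) : b i \in X by exact: (fintype.subsetP (VX i) _ (bV i)).
have ainj : injective a by move=> i j e; apply: (Veq _ _ (a i)); rewrite // e.
have binj : injective b by move=> i j e; apply: (Veq _ _ (b i)); rewrite // e.
have [s [sP sload]] := route I a b aX bX ainj binj.
(* The terminals occupy copies with index [< m]; an inner vertex [z] of the
   [i]-th path is lifted to the copy [m + r], where [r] is the rank of [i] among
   the paths running through [z]. *)
pose thru z := [pred i | [&& z \in s i, z != (a i).1 & z != (b i).1]].
pose rk i z := (m + index i (enum (thru z)))%nat.
have rkt i z : thru z i -> (rk i z < t)%nat.
  move=> zi; have := sload z; rewrite -/(thru z) => ld.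
  have : (index i (enum (thru z)) < #|thru z|)%nat by rewrite cardE index_mem mem_enum.
  rewrite /rk; lia.
(* The default of [insubd] is never reached for [z] on [s i], where the rank is below [t] by
   [rkt]. *)
pose f i z := if z == (a i).1 then a i else if z == (b i).1 then b i
              else (z, insubd (a i).2 (rk i z)).
have f1 i z : (f i z).1 = z.
  by rewrite /f; case: eqP => [->|_] //; case: eqP => [->|_].
have fE i z : z \in s i ->
    f i z \in v i \/ thru z i /\ nat_of_ord (f i z).2 = rk i z.
  move=> zi; rewrite /f; case: eqP => [_|/eqP za]; first by left.
  case: eqP => [_|/eqP zb]; first by left.
  have tz : thru z i by rewrite /= zi za zb.
  by right; split=> //=; rewrite val_insubd rkt.
(* Two terminals over the same vertex are adjacent in the blowup; the one-vertex route between their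
   projections would lift to only one of them. *)
pose p i := if (a i).1 == (b i).1 then [:: a i; b i] else map (f i) (s i).
have pE i z : z \in p i -> z \in v i \/ thru z.1 i /\ nat_of_ord z.2 = rk i z.1.
  rewrite /p; case: eqP => _.
    by rewrite !inE => /orP[]/eqP ->; left.
  by move=> /mapP[w ws ->]; rewrite f1; exact: fE.
have pP i : is_path_uv (blowup E t) (a i) (b i) (p i).
  rewrite /p; have [/= neq _] := abP i; case: eqP => [e1|/eqP ne1].
    rewrite /= !eqxx inE neq /= andbT /blowup e1 eqxx /=; apply/orP; right.
    by apply: contra neq => /eqP e2; apply/eqP; exact: injective_projections.
  have := sP i; case: (s i) => // x l /= /and4P[/eqP -> /eqP lst un pth].
  have fb : f i (b i).1 = b i by rewrite /f eq_sym (negbTE ne1) eqxx.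
  rewrite {1}/f eqxx eqxx /= last_map lst fb eqxx /=.
  have finj : injective (f i) by move=> z w /(congr1 fst); rewrite !f1.
  rewrite (mem_map finj) (map_inj_uniq finj) un /=.
  rewrite path_map; apply: sub_path pth => z w zw.
  by rewrite /= /blowup !f1 zw.
have pdisj (i j : I) z : z \in p i -> z \in p j -> i = j.
  move=> /pE zi /pE zj; case: zi zj => [vi|[ti ri]] [vj|[tj rj]].
  - exact: Veq vi vj.
  - by have := Xm z (fintype.subsetP (VX i) _ vi); rewrite rj /rk ltnNge leq_addr.
  - by have := Xm z (fintype.subsetP (VX j) _ vj); rewrite ri /rk ltnNge leq_addr.
  - apply: (@index_enum_inj _ (thru z.1)) => //.
    by apply/eqP; rewrite -(eqn_add2l m) -[X in X == _]ri -[X in _ == X]rj.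
exists (fun e => oapp p [::] (insub e)); split=> [e eM|e g eM gM eg].
  exists (a (exist _ e eM)), (b (exist _ e eM)).
  rewrite insubT /=; split; last exact: pP.
  by have [_ /= <-] := abP (exist _ e eM).
rewrite !insubT /=; apply/pred0P => z /=; apply/negP => /andP[zi zj].
by have /(congr1 v)/= /eqP := pdisj _ _ _ zi zj; rewrite (negbTE eg).
Qed.

(** * Integral routing along the concurrent flow *)

Lemma card_sum_fibers (I K : finType) (tau : I -> K) (A : pred I) :
  #|A| = (\sum_k #|[pred i | (tau i == k) && A i]|)%nat.
Proof.
rewrite -sum1_card (partition_big tau predT) //=; apply: eq_bigr => k _.
by rewrite -sum1_card; apply: eq_bigl => i; rewrite !inE andbC.
Qed.

(** The scaled flow [x / eps] sends at least one unit between any two vertices of [W]. Rounding it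
    for at most [D] pairs of each type loads a vertex by [D / eps] times its capacity 1, plus at
    most one per path of [H]. *)
Lemma route_pairs (V : finType) (E : rel V) (W : {set V}) (eps : R)
    (x : seq V -> R) (I : finType) (a b : I -> V) (D : R) :
  cflow_feasible E W 1 eps x -> 0 < eps -> 0 <= D ->
  (forall i, a i \in W) -> (forall i, b i \in W) ->
  (forall u v, #|[pred i | (a i == u) && (b i == v)]|%:R <= D) ->
  exists p : I -> seq V, (forall i, is_path_uv E (a i) (b i) (p i)) /\
    forall z, #|[pred i | z \in p i]|%:R <=
      D / eps + (\sum_(k : V * V) size (paths_uv E k.1 k.2))%nat%:R.
Proof.
move=> [xeps xcap x0] e0 D0 aW bW abD.
pose s (k : V * V) := paths_uv E k.1 k.2.
pose tau i := (a i, b i).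
have y0 (k : V * V) p : 0 <= x p / eps by rewrite divr_ge0 // ltW.
have y1 i : 1 <= \sum_(p <- s (tau i)) x p / eps.
  by rewrite -mulr_suml ler_pdivlMr // mul1r; exact: (xeps _ _ (aW i) (bW i)).
have [p [ps pP]] := fractional_rounding [::] y0 y1.
exists p; split=> [i|z]; first by have := ps i; rewrite mem_filter => /andP[].
rewrite (card_sum_fibers tau) !natr_sum.
pose inW (k : V * V) := (k.1 \in W) && (k.2 \in W).
pose load (k : V * V) := \sum_(q <- s k | z \in q) x q.
have load0 k : 0 <= load k by apply: sumr_ge0 => q _; exact: x0.
(* The capacity constraint sums over pairs in [W] only; every other type has an empty fibre. *)
apply: (@le_trans _ _ (\sum_k ((if inW k then D / eps * load k else 0)
                               + (size (s k))%:R))).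
  apply: ler_sum => -[u v] _; case: ifP => uvW.
    apply: le_trans (pP (u, v) (fun q => z \in q)) _; rewrite lerD2r -mulr_suml -/(load _).
    rewrite [D / eps * _]mulrAC -mulrA ler_wpM2r //.
      by rewrite divr_ge0 // ltW.
    by apply: le_trans (abD u v); rewrite ler_nat.
  rewrite add0r ler_nat [X in (X <= _)%nat](_ : _ = 0) //.
  apply: eq_card0 => i; rewrite !inE; apply/negP => /andP[/eqP[au bv] _].
  by move: uvW; rewrite /inW /= -au -bv aW bW.
rewrite big_split /= lerD2r -big_mkcond -mulr_sumr ler_piMr //.
  by rewrite divr_ge0 // ltW.
by have := xcap z; rewrite pair_big.
Qed.

(** The concatenated walk may repeat vertices; shortcutting it restores distinctness and adds no
    vertex, so loads do not grow. *)
Lemma is_path_uv_trans (V : finType) (E : rel V) (u w v : V) (p q : seq V) :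
  is_path_uv E u w p -> is_path_uv E w v q ->
  exists2 s, is_path_uv E u v s & {subset s <= p ++ q}.
Proof.
case: p => // x p /= /and4P[/eqP -> /eqP lp _ pp].
case: q => // y q /= /and4P[/eqP -> /eqP lq _ pq].
have pth : path E u (p ++ q) by rewrite cat_path pp lp.
have lst : last u (p ++ q) = v by rewrite last_cat lp.
case/shortenP: pth lst => l pl ul sl lst.
exists (u :: l); first by rewrite /= eqxx lst eqxx pl andbT; exact: ul.
move=> z; rewrite inE => /orP[/eqP->|/sl]; first by rewrite mem_head.
rewrite mem_cat inE mem_cat inE => /orP[->|->]; by rewrite ?orbT.
Qed.

(* Valiant's trick: each pair is routed through an intermediate vertex of [W],
   the pairs of each type being spread evenly over [W]. This turns an arbitrary
   demand with bounded degrees into two nearly uniform ones. *)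
Lemma route_bounded_degree (V : finType) (E : rel V) (W : {set V}) (eps : R)
    (x : seq V -> R) (I : finType) (a b : I -> V) (m : nat) :
  cflow_feasible E W 1 eps x -> 0 < eps -> W != finset.set0 ->
  (forall i, a i \in W) -> (forall i, b i \in W) ->
  (forall u, (#|[pred i | a i == u]| <= m)%nat) ->
  (forall u, (#|[pred i | b i == u]| <= m)%nat) ->
  exists s : I -> seq V, (forall i, is_path_uv E (a i) (b i) (s i)) /\
    forall z, #|[pred i | z \in s i]|%:R <=
      2 * ((m%:R / #|W|%:R + (#|V| * #|W|)%nat%:R) / eps
           + (\sum_(k : V * V) size (paths_uv E k.1 k.2))%nat%:R).
Proof.
move=> xP e0 W0 aW bW am bm.
have k0 : 0 < #|W|%:R :> R by rewrite ltr0n card_gt0.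
have [w0 w0W] := set0Pn _ W0.
pose tau i := (a i, b i).
pose y (_ : V * V) (_ : V) : R := #|W|%:R^-1.
have y0 k o : 0 <= y k o by rewrite invr_ge0 ltW.
have y1 i : 1 <= \sum_(o <- enum W) y (tau i) o.
  rewrite big_const_seq iter_addr addr0 count_predT -cardE.
  by rewrite /y -[leRHS]mulr_natr mulVf // gt_eqF.
have [w [wW wP]] := fractional_rounding w0 (s := fun=> enum W) y0 y1.
have {}wW i : w i \in W by have := wW i; rewrite mem_enum.
have cell u v o : #|[pred i | (tau i == (u, v)) && (w i == o)]|%:R <=
    #|[pred i | tau i == (u, v)]|%:R / #|W|%:R + #|W|%:R :> R.
  apply: le_trans (wP _ (pred1 o)) _; rewrite -cardE lerD2r ler_wpM2l //.
  rewrite big_const_seq iter_addr addr0 -[leRHS]mulr1n ler_wpMn2l ?invr_ge0 ?ltW //.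
  by rewrite count_uniq_mem ?enum_uniq // leq_b1.
(* Sum the bound [cell] over the [#|V|] possible opposite ends, whose fibres have at most [m]
   elements in total. *)
pose D : R := m%:R / #|W|%:R + (#|V| * #|W|)%nat%:R.
have D0 : 0 <= D by rewrite addr_ge0 // divr_ge0 // ltW.
have sumD (c : V -> nat) : (\sum_u c u <= m)%nat ->
    \sum_u ((c u)%:R / #|W|%:R + #|W|%:R) <= D.
  move=> cm; rewrite big_split /= sumr_const -mulr_suml -natr_sum.
  rewrite /D natrM [X in _ <= _ + X]mulr_natl lerD2r.
  by rewrite ler_pM2r ?invr_gt0 // ler_nat.
have awD u o : #|[pred i | (a i == u) && (w i == o)]|%:R <= D.
  rewrite (card_sum_fibers b) natr_sum.
  apply: le_trans (sumD (fun v => #|[pred i | tau i == (u, v)]|) _).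
    apply: ler_sum => v _; apply: le_trans (cell u v o); rewrite ler_nat.
    apply: subset_leq_card; apply/fintype.subsetP => i; rewrite !inE xpair_eqE.
    by move=> /and3P[-> -> ->].
  apply: leq_trans (am u); rewrite [leqRHS](card_sum_fibers b).
  apply: leq_sum => v _; apply: subset_leq_card; apply/fintype.subsetP => i.
  by rewrite !inE xpair_eqE andbC.
have wbD o v : #|[pred i | (w i == o) && (b i == v)]|%:R <= D.
  rewrite (card_sum_fibers a) natr_sum.
  apply: le_trans (sumD (fun u => #|[pred i | tau i == (u, v)]|) _).
    apply: ler_sum => u _; apply: le_trans (cell u v o); rewrite ler_nat.
    apply: subset_leq_card; apply/fintype.subsetP => i; rewrite !inE xpair_eqE.
    by move=> /and3P[-> -> ->].
  apply: leq_trans (bm v); rewrite [leqRHS](card_sum_fibers a).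
  apply: leq_sum => u _; apply: subset_leq_card; apply/fintype.subsetP => i.
  by rewrite !inE xpair_eqE.
have [p [pP pz]] := route_pairs xP e0 D0 aW wW awD.
have [q [qP qz]] := route_pairs xP e0 D0 wW bW wbD.
have /fin_all_exists[s sP] i : exists s, is_path_uv E (a i) (b i) s
    /\ {subset s <= p i ++ q i}.
  by have [s s1 s2] := is_path_uv_trans (pP i) (qP i); exists s.
exists s; split=> [i|z]; first by case: (sP i).
(* A route through [z] meets [z] in one of its two halves, whence the factor 2. *)
rewrite mulr_natl mulr2n; apply: le_trans (lerD (pz z) (qz z)).
rewrite -natrD ler_nat -cardUI; apply: leq_trans (leq_addr _ _).
apply: subset_leq_card; apply/fintype.subsetP => i; rewrite !inE => zs.
by rewrite -mem_cat; case: (sP i) => _; apply.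
Qed.

(** * Matching-linked sets of prescribed size *)

Lemma card_fiber_fst (V I : finType) (t m : nat) (a : I -> V * 'I_t) (u : V) :
  injective a -> (forall i, ((a i).2 < m)%nat) ->
  (#|[pred i | (a i).1 == u]| <= m)%nat.
Proof.
move=> ainj am; pose g i := Ordinal (am i).
rewrite -[X in (_ <= X)%nat]card_ord -(@card_in_image _ _ g); first exact: max_card.
move=> i j; rewrite !inE => /eqP iu /eqP ju /(congr1 val)/= ij.
by apply/ainj/injective_projections; [rewrite iu ju | exact/val_inj].
Qed.

(** Any [n] of the copies with index below [m] over [W] will do: at most [m] lie over one vertex,
    which bounds the degrees of the demand. *)
Lemma exists_matching_linked (V : finType) (E : rel V) (W : {set V}) (eps : R)
    (x : seq V -> R) (t m n : nat) :
  cflow_feasible E W 1 eps x -> 0 < eps -> W != finset.set0 ->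
  (n <= #|W| * m)%nat -> (m <= t)%nat ->
  2 * ((m%:R / #|W|%:R + (#|V| * #|W|)%nat%:R) / eps
       + (\sum_(k : V * V) size (paths_uv E k.1 k.2))%nat%:R) + m%:R <= t%:R ->
  exists X : {set V * 'I_t}, #|X| = n /\ matching_linked (blowup E t) X.
Proof.
move=> xP e0 W0 nm mt slack.
pose X0 := finset.setX W [set i : 'I_t | (i < m)%nat].
have cX0 : #|X0| = (#|W| * m)%nat.
  rewrite cardsX; congr muln.
  have -> : [set i : 'I_t | (i < m)%nat] = [set widen_ord mt i | i : 'I_m].
    apply/setP => i; rewrite inE; apply/idP/imsetP => [im|[j _ ->]] /=.
      by exists (Ordinal im) => //; apply/val_inj.
    exact: ltn_ord.
  by rewrite card_imset ?card_ord // => i j /(congr1 val)/= /val_inj.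
have /card_geqP[s [us ss sX0]] : (n <= #|X0|)%nat by rewrite cX0.
exists [set z in s]; split; first by rewrite cardsE (card_uniqP us).
have inX z : z \in [set z in s] -> z.1 \in W /\ (z.2 < m)%nat.
  by rewrite inE => /sX0; rewrite !inE => /andP[].
apply: (matching_linked_of_routing mt) => [z /inX[]//|I a b aX bX ainj binj].
have aW i : (a i).1 \in W by case: (inX _ (aX i)).
have bW i : (b i).1 \in W by case: (inX _ (bX i)).
have am u : (#|[pred i | (a i).1 == u]| <= m)%nat.
  by apply: card_fiber_fst => // i; case: (inX _ (aX i)).
have bm u : (#|[pred i | (b i).1 == u]| <= m)%nat.
  by apply: card_fiber_fst => // i; case: (inX _ (bX i)).
have [r [rP rz]] := route_bounded_degree xP e0 W0 aW bW am bm.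
exists r; split=> // z; rewrite -(ler_nat R) natrB // lerBrDr.
apply: le_trans slack; rewrite lerD2r; apply: le_trans (rz z); rewrite ler_nat.
by apply: subset_leq_card; apply/fintype.subsetP => i; rewrite !inE => /and3P[].
Qed.

(** * Choice of constants and the bound on the capacity *)

(** Every path starting at [u] contains [u], so [u] carries at least [eps] for each of its [#|W|]
    targets. *)
Lemma card_mul_eps_le1 (V : finType) (E : rel V) (W : {set V}) (eps : R)
    (x : seq V -> R) :
  cflow_feasible E W 1 eps x -> W != finset.set0 -> #|W|%:R * eps <= 1.
Proof.
move=> [xeps xcap x0] /set0Pn[u uW]; apply: le_trans (xcap u).
rewrite (bigD1 u) //= -[leLHS]addr0 lerD //; last first.
  by do 3![apply: sumr_ge0 => ? _].
rewrite mulr_natl -sumr_const; apply: ler_sum => v vW.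
apply: le_trans (xeps u v uW vW) _.
rewrite big_seq [leRHS]big_seq_cond [leRHS]big_mkcond [leLHS]big_mkcond.
apply: ler_sum => p _; case: ifP => // pE; rewrite ifT //=.
move: pE; rewrite mem_filter; case: p => // z p /andP[/and4P[/eqP -> _ _ _] _].
by rewrite mem_head.
Qed.

Lemma natz_truncn_floor (y : R) : 0 <= y -> (Num.truncn y)%:Z = Num.floor y.
Proof. by move=> y0; rewrite truncn_floor y0 gez0_abs // floor_ge0. Qed.

Lemma linkage_capacity_ge (V : finType) (E : rel V) (W : {set V}) (eps : R)
    (x : seq V -> R) :
  cflow_feasible E W 1 eps x -> 0 < eps -> W != finset.set0 ->
  ((eps * (#|W|%:R ^+ 2 / 108))%:E <= linkage_capacity E)%E.
Proof.
move=> xP e0 W0; apply: ereal_sup_ubound.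
exists (eps * (#|W|%:R ^+ 2 / 108)) => //=; set c := eps * _.
set k : R := #|W|%:R.
have k0 : 0 < k by rewrite ltr0n card_gt0.
have ke1 : k * eps <= 1 := card_mul_eps_le1 xP W0.
have ke0 : 0 < k * eps by rewrite mulr_gt0.
have cE : c = k * (k * eps) / 108.
  by rewrite /c -/k expr2; ring.
have c0 : 0 < c by rewrite cE divr_gt0 // mulr_gt0.
split=> //.
set N : R := (\sum_(k : V * V) size (paths_uv E k.1 k.2))%nat%:R.
set VW : R := (#|V| * #|W|)%nat%:R.
(* [B] collects the parts of the slack inequality that do not grow with [t]. The growing parts
   amount to at most [3 * t / 108], so [2 * B <= t] suffices. *)
pose B := 2 * ((k * eps)^-1 + VW / eps + N) + 1.
have B0 : 0 <= B.
  by rewrite addr_ge0 // mulr_ge0 // !addr_ge0 // ?divr_ge0 ?invr_ge0 // ltW.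
exists (Num.bound (2 * B)) => t tB.
have {}tB : 2 * B <= t%:R.
  apply/ltW/(lt_le_trans (archi_boundP _)); first by rewrite mulr_ge0.
  by rewrite ler_nat.
(* The successor gives [k * m > c * t], enough room for the floor of [c * t] terminals. *)
pose m := (Num.truncn (c * t%:R / k)).+1.
have ctk0 : 0 <= c * t%:R / k by rewrite divr_ge0 ?mulr_ge0 // ltW.
have ctk : c * t%:R / k = k * eps * t%:R / 108 by rewrite cE; field; rewrite gt_eqF.
have m1 : m%:R <= k * eps * t%:R / 108 + 1.
  by rewrite -ctk /m -natr1 lerD2r truncn_le.
(* Here [k * eps <= 1] keeps the terminals over a vertex to about [t / 108]. *)
have m2 : m%:R <= t%:R / 108 + 1 :> R.
  apply: (le_trans m1); rewrite lerD2r ler_pM2r ?invr_gt0 //.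
  by rewrite ler_piMl.
have m3 : m%:R / k / eps <= t%:R / 108 + (k * eps)^-1.
  rewrite -mulrA -invfM ler_pdivrMr // mulrDl mulVf ?gt_eqF //.
  by apply: (le_trans m1); rewrite lerD2r; lra.
have slack : 2 * ((m%:R / k + VW) / eps + N) + m%:R <= t%:R.
  have t0 : 0 <= t%:R :> R by [].
  rewrite [(_ + VW) / _]mulrDl; move: m2 m3 tB t0; rewrite /B.
  move: (m%:R / k / eps) (k * eps)^-1 (VW / eps) (m%:R : R) (t%:R : R).
  by move=> p q r m4 t4; lra.
have N0 : 0 <= N by [].
have mt : (m <= t)%nat.
  rewrite -(ler_nat R); apply: le_trans slack; rewrite lerDr.
  by rewrite mulr_ge0 // addr_ge0 // divr_ge0 ?addr_ge0 ?divr_ge0 // ltW.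
have nm : (Num.truncn (c * t%:R) <= #|W| * m)%nat.
  rewrite -(ler_nat R) natrM -/k; apply: (@le_trans _ _ (c * t%:R)).
    by rewrite truncn_le mulr_ge0 // ltW.
  by rewrite [leRHS]mulrC -ler_pdivrMr // ltW // -truncn_lt_nat.
have [X [XE XL]] := exists_matching_linked xP e0 W0 nm mt slack.
by exists X; split=> //; rewrite XE natz_truncn_floor // mulr_ge0 // ltW.
Qed.

(** The copies of one vertex form a clique of size [t], so the capacity is even at least 1. This
    settles nonpositive flow values. *)
Lemma linkage_capacity_ge0 (V : finType) (E : rel V) (u : V) :
  (0 <= linkage_capacity E)%E.
Proof.
apply: (@le_trans _ _ 1%:E) => //; apply: ereal_sup_ubound.
exists 1 => //=; split=> //; exists 0 => t _.
exists (finset.setX [set u] [set: 'I_t]); split.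
  by rewrite cardsX cards1 cardsT card_ord mul1n mul1r -[t%:R]/(t%:~R) intrKfloor.
(* With [m = t] no copy is left for inner vertices, and one-vertex routes have none. *)
apply: (@matching_linked_of_routing _ _ _ t) => // I a b aX bX _ _.
exists (fun=> [:: u]); split=> [i|z].
  by move: (aX i) (bX i); rewrite !inE !andbT => /eqP-> /eqP->; rewrite /= !eqxx.
rewrite subnn leqn0; apply/eqP/eq_card0 => i; rewrite !inE.
by move: (aX i); rewrite !inE andbT => /eqP ->; case: eqP.
Qed.

Theorem mainTheorem17 (V : finType) (E : rel V) (W : {set V}) :
  simple_graph E -> W != finset.set0 ->
  (eps_HW E W * ((#|W| ^ 2)%:R / 108 : R)%:E <= linkage_capacity E)%E.
Proof.
move=> _ W0; have [u _] := set0Pn _ W0.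
(* The cast to [R] in the statement switches to [R_scope], so [K] is built from
   Stdlib's [Nat.pow], [Rdiv] and [IZR]. *)
set K : R := (X in (_ * X%:E)%E).
have KE : K = #|W|%:R ^+ 2 / 108.
  rewrite /K RdivE IZRposE INRE; congr (_ / _).
  by rewrite expr2 -natrM; congr (_%:R); exact: (congr1 (muln #|W|) (muln1 #|W|)).
have K0 : 0 < K by rewrite KE divr_gt0 // exprn_gt0 // ltr0n card_gt0.
(* Dividing by [K > 0] isolates the supremum, so each feasible value can be treated separately. *)
rewrite -lee_pdivlMr //; apply: ge_ereal_sup => _ /= [e [x xP] <-].
rewrite lee_pdivlMr // -EFinM KE.
have [e0|e0] := ltP 0 e; first exact: linkage_capacity_ge xP e0 W0.
apply: le_trans (linkage_capacity_ge0 E u).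
by rewrite lee_fin mulr_le0_ge0 // -KE ltW.
Qed.
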